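(* Let $v,k$ and real numbers $\lambda_0,\lambda_1$ with $0\le\lambda_0\le 1/k$, $0\le\lambda_1\le1$ be given, and let $\pi^*$ be one of the optimal orders listed in the context for these values (list (L1)-(L5)). Let $k^*$ be the number of distinct treatments in $\pi^*$, and suppose $b$ is such that a $k^*\times b$ semibalanced array based on $v$ treatments, with rows uniform in symbols, exists. Let $$\widetilde{d}^*=\Pi\begin{pmatrix}\widetilde{d}_1^*\\ \widetilde{d}_2^*\end{pmatrix}$$ be a $k\times b$ array, where $\widetilde{d}_1^*$ is such a $k^*\times b$ semibalanced array, each row of $\widetilde{d}_2^*$ is identical to some row of $\widetilde{d}_1^*$, and $\Pi$ is a permutation matrix of order $k$ such that, after relabeling treatments if necessary, $\widetilde{d}^*(p,1)=\pi^*(p)$ for $p=1,\dots,k$. Then $\widetilde{d}^*$ is a maximin universally optimal design.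
   Context: Let $v,b\ge1$, $k\ge2$ be integers. A design is a $k\times b$ array $d$ with entries $d(p,j)\in\{1,\dots,v\}$ (treatment on unit $p$ of block $j$); $D$ is the set of all such designs. $\phi(p)=\sqrt{3/(k(k^2-1))}\,(2p-k-1)$, $\phi=(\phi(1),\dots,\phi(k))'$; $\mathbf{1}_k$ is the vector of ones and $\mathbf{I}_k$ the identity matrix. Minimal information matrix: with $\sigma_{0\varepsilon}^2>0$ a fixed constant, $C_d^L$ is the $v\times v$ matrix $$\sigma_{0\varepsilon}^2C_d^L=\sum_{j=1}^bX_{dj}'WX_{dj}-\left(\frac{1-k\lambda_0}{bk}\right)\mathbf{r}_d\mathbf{r}_d'-\left(\frac{1-\lambda_1}{b}\right)M_d\phi\phi'M_d',\qquad W=\mathbf{I}_k-\lambda_0\mathbf{1}_k\mathbf{1}_k'-\lambda_1\phi\phi',$$ where $X_{dj}$ is the $k\times v$ matrix with $(p,i)$ entry $1$ if $d(p,j)=i$ and $0$ otherwise, $\mathbf{r}_d$ is the $v\times1$ vector whose $i$th entry is the number of cells of $d$ containing $i$, and $M_d$ is the $v\times k$ matrix whose $(i,p)$ entry is the number of blocks $j$ with $d(p,j)=i$. Maximin universally optimal: a design $d^*\in D$ such that $C_{d^*}^L$ is completely symmetric (all diagonal entries equal, all off-diagonal entries equal) and $\operatorname{trace}(C_{d^*}^L)=\max_{d\in D}\operatorname{trace}(C_d^L)$. Semibalanced array (orthogonal array of type II of strength 2): an array in $v$ symbols whose columns each consist of distinct symbols and such that any two rows contain every (unordered) pair of distinct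 symbols equally often as columns. A row is uniform in symbols if each of the $v$ symbols occurs equally often in it. If $k^*=k$ the array $\widetilde d_2^*$ is empty. An order is a sequence $\pi=(\pi(1),\dots,\pi(k))$ with entries in $\{1,\dots,v\}$. For an order, $n_i$ is the number of $p$ with $\pi(p)=i$, and $h_i=\sum_{p:\pi(p)=i}\phi(p)$. For an integer $q\ge\max\{0,k-v\}$ with $q\le k/2$, $\pi_q$ denotes an order of the form $(i_1,\dots,i_q,i_{q+1},\dots,i_{k-q},i_q,\dots,i_1)$ with $i_1,\dots,i_{k-q}$ distinct treatments ($\pi_0$ is an order of $k$ distinct treatments). Let $s^*=\max\{p\text{ integer}:1\le p<\frac{k+1}{2},\ \lambda_1\phi^2(p)>\lambda_0\}$ if $\lambda_1\phi^2(1)>\lambda_0$, and $s^*=0$ if $\lambda_1\phi^2(1)\le\lambda_0$. For $k\ge2v$ write $k=mv+t$ with integers $0\le t<v$, $m\ge2$. Say that an order has structure (S) if $n_1=\dots=n_t=m+1$, $n_{t+1}=\dots=n_v=m$ (no treatment has replication $m+1$ if $t=0$), and treatments with even replication occupy exactly the outer positions ($1,\dots,(m+1)t/2$ and $k-(m+1)t/2+1,\dots,k$ if $m$ is odd; $1,\dots,m(v-t)/2$ and $k-m(v-t)/2+1,\dots,k$ if $m$ is even), arranged there so that $\pi(p)=\pi(k-p+1)$; treatments with odd replication occupy the remaining inner positions. - $\pi_{TF}^A$ ($k$ odd): any order with structure (S) in which the treatments with odd replication are arranged so that $h_i=0$ for each of them. - $\pi_{TF}^B$ ($k$ even, $k/v$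 an even integer): any order with $n_i=m$ for all $i$ and $\pi(p)=\pi(k-p+1)$ for $p=1,\dots,k/2$. - $\pi_{TF}^C$ ($k$ even, $k/v$ not an even integer): any order with $n_i\in\{\xi,\xi+2\}$ for all $i=1,\dots,v$, where $\xi$ is the even integer in $\{m-1,m\}$, and $\pi(p)=\pi(k-p+1)$ for $p=1,\dots,k/2$. - $\pi_{NTF}$ ($k$ even, $k/v$ not an even integer): any order with structure (S) in which the treatments with odd replication are arranged so that $|h_i|=\phi\left(\frac{k+2}{2}\right)=-\phi\left(\frac k2\right)$ for each of them. List of optimal orders $\pi^*$: (L1) if $k<2v$ and $k\le v+s^*$: $\pi^*=\pi_{s^*}$; (L2) if $k<2v$ and $k>v+s^*$: $\pi^*=\pi_{\alpha}$ with $\alpha=k-v$; (L3) if $k\ge2v$ and $k$ is odd: $\pi^*=\pi_{TF}^A$; (L4) if $k\ge2v$, $k$ is even and $k/v$ is an even integer: $\pi^*=\pi_{TF}^B$; (L5) if $k\ge2v$, $k$ is even and $k/v$ is not an even integer: $\pi^*=\pi_{TF}^C$ if $\lambda_1\phi^2(k/2)>\lambda_0$, and $\pi^*=\pi_{NTF}$ if $\lambda_1\phi^2(k/2)\le\lambda_0$. *)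

(* Defs.v *)
From mathcomp Require Import all_boot all_order all_fingroup all_algebra.
Set Implicit Arguments.
Unset Strict Implicit.
Unset Printing Implicit Defensive.
Import Order.TTheory GRing.Theory Num.Theory.
Local Open Scope ring_scope.

(* Conventions.  Treatments, units and blocks are ordinals, hence numbered from
   0: unit p of the mathematical text is the ordinal of value p - 1, and the
   mirror unit k - p + 1 is [rev_ord].  A design is a matrix of treatments, an
   order is a k-tuple of treatments.  The reals are any real closed field (only
   order and square roots are used). *)

Definition design (v k b : nat) := 'M['I_v]_(k, b).

Definition block_order (v k : nat) := k.-tuple 'I_v.

(* [phi k p] takes p numbered from 1. *)
Definition phi (R : rcfType) (k p : nat) : R :=
  Num.sqrt (3 / (k%:R * (k%:R ^+ 2 - 1))) * (2 * p%:R - k%:R - 1).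

Definition phi_col (R : rcfType) (k : nat) : 'cV[R]_k := \col_p phi R k p.+1.

Definition ones (R : rcfType) (k : nat) : 'cV[R]_k := const_mx 1.

(** Information matrix *)

Definition incidence (R : rcfType) (v k b : nat) (d : design v k b) (j : 'I_b) :
    'M[R]_(k, v) :=
  \matrix_(p, i) (d p j == i)%:R.

Definition replication (R : rcfType) (v k b : nat) (d : design v k b) :
    'cV[R]_v :=
  \col_i #|[set c : 'I_k * 'I_b | d c.1 c.2 == i]|%:R.

Definition unit_incidence (R : rcfType) (v k b : nat) (d : design v k b) :
    'M[R]_(v, k) :=
  \matrix_(i, p) #|[set j : 'I_b | d p j == i]|%:R.

Definition weight (R : rcfType) (k : nat) (lambda0 lambda1 : R) : 'M[R]_k :=
  1%:M - lambda0 *: (ones R k *m (ones R k)^T)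
       - lambda1 *: (phi_col R k *m (phi_col R k)^T).

(* [sigma2] is the variance sigma_{0 epsilon}^2. *)
Definition min_info (R : rcfType) (v k b : nat) (sigma2 lambda0 lambda1 : R)
    (d : design v k b) : 'M[R]_v :=
  sigma2^-1 *:
    (\sum_(j < b)
        (incidence R d j)^T *m weight k lambda0 lambda1 *m incidence R d j
     - ((1 - k%:R * lambda0) / (b%:R * k%:R)) *:
         (replication R d *m (replication R d)^T)
     - ((1 - lambda1) / b%:R) *:
         (unit_incidence R d *m phi_col R k *m (phi_col R k)^T
            *m (unit_incidence R d)^T)).

Definition completely_symmetric (R : rcfType) (v : nat) (A : 'M[R]_v) : Prop :=
  (forall i i', A i i = A i' i') /\
  (forall i1 i2 i3 i4, i1 != i2 -> i3 != i4 -> A i1 i2 = A i3 i4).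

Definition maximin_universally_optimal (R : rcfType) (v k b : nat)
    (sigma2 lambda0 lambda1 : R) (d : design v k b) : Prop :=
  completely_symmetric (min_info sigma2 lambda0 lambda1 d) /\
  (forall d' : design v k b,
     \tr (min_info sigma2 lambda0 lambda1 d')
       <= \tr (min_info sigma2 lambda0 lambda1 d)).

(** Semibalanced arrays *)

Definition semibalanced (v k b : nat) (d : 'M['I_v]_(k, b)) : Prop :=
  (forall j, injective (fun p => d p j)) /\
  (forall p p', p != p' ->
   forall i1 i2 i3 i4 : 'I_v, i1 != i2 -> i3 != i4 ->
     #|[set j | [set d p j; d p' j] == [set i1; i2]]|
     = #|[set j | [set d p j; d p' j] == [set i3; i4]]|).

Definition uniform_rows (v k b : nat) (d : 'M['I_v]_(k, b)) : Prop :=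
  forall p (i i' : 'I_v), #|[set j | d p j == i]| = #|[set j | d p j == i']|.

(** Orders *)

Definition n_distinct (v k : nat) (pi : block_order v k) : nat :=
  #|[set tnth pi p | p : 'I_k]|.

Definition rep (v k : nat) (pi : block_order v k) (i : 'I_v) : nat :=
  #|[set p | tnth pi p == i]|.

Definition contrast (R : rcfType) (v k : nat) (pi : block_order v k) (i : 'I_v) : R :=
  \sum_(p < k | tnth pi p == i) phi R k p.+1.

Definition mirrored (v k : nat) (pi : block_order v k) : Prop :=
  forall p : 'I_k, tnth pi p = tnth pi (rev_ord p).

(* [(k - v <= q)%N] is q >= max(0, k - v), since subtraction is truncated. *)
Definition is_pi_q (v k q : nat) (pi : block_order v k) : Prop :=
  [/\ (k - v <= q)%N, (q.*2 <= k)%N &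
      exists s : seq 'I_v,
        [/\ uniq s, size s = (k - q)%N & tval pi = s ++ rev (take q s)]].

(* The maximum is over p with 1 <= p < (k + 1) / 2. *)
Definition s_star (R : rcfType) (k : nat) (lambda0 lambda1 : R) : nat :=
  if lambda0 < lambda1 * phi R k 1 ^+ 2 then
    (\max_(1 <= p < k.+1 | (p.*2 < k.+1)%N
                           && (lambda0 < lambda1 * phi R k p ^+ 2)%R) p)%N
  else 0%N.

(* Number of treatment cells in each of the two outer zones of structure (S);
   the halved products are even. *)
Definition outer_width (v k : nat) : nat :=
  let m := (k %/ v)%N in let t := (k %% v)%N in
  if odd m then (m.+1 * t)./2 else (m * (v - t))./2.

Definition outer (v k : nat) (p : 'I_k) : bool :=
  (p < outer_width v k)%N || (k - outer_width v k <= p)%N.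

(* Structure (S), with k = m v + t for m = k %/ v and t = k %% v. *)
Definition structure_S (v k : nat) (pi : block_order v k) : Prop :=
  [/\ forall i : 'I_v,
        rep pi i = if (i < k %% v)%N then (k %/ v).+1 else (k %/ v)%N,
      forall p : 'I_k, ~~ odd (rep pi (tnth pi p)) = outer v p &
      forall p : 'I_k, outer v p -> tnth pi p = tnth pi (rev_ord p)].

Definition is_pi_TFA (R : rcfType) (v k : nat) (pi : block_order v k) : Prop :=
  structure_S pi /\ (forall i, odd (rep pi i) -> contrast R pi i = 0).

Definition is_pi_TFB (v k : nat) (pi : block_order v k) : Prop :=
  (forall i, rep pi i = (k %/ v)%N) /\ mirrored pi.

Definition even_floor (m : nat) : nat := if odd m then m.-1 else m.

Definition is_pi_TFC (v k : nat) (pi : block_order v k) : Prop :=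
  (forall i, rep pi i = even_floor (k %/ v) \/
             rep pi i = (even_floor (k %/ v)).+2) /\
  mirrored pi.

Definition is_pi_NTF (R : rcfType) (v k : nat) (pi : block_order v k) : Prop :=
  structure_S pi /\
  (forall i, odd (rep pi i) -> `|contrast R pi i| = phi R k (k.+2)./2).

Definition optimal_order (R : rcfType) (v k : nat) (lambda0 lambda1 : R)
    (pi : block_order v k) : Prop :=
  if (k < 2 * v)%N then
    if (k <= v + s_star k lambda0 lambda1)%N
    then is_pi_q (s_star k lambda0 lambda1) pi
    else is_pi_q (k - v) pi
  else if odd k then is_pi_TFA R pi
  else if (v %| k)%N && ~~ odd (k %/ v) then is_pi_TFB pi
  else if lambda0 < lambda1 * phi R k k./2 ^+ 2 then is_pi_TFC pi
  else is_pi_NTF R pi.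

(* Main.v *)
Require Import Defs.
From mathcomp Require Import all_boot all_order all_fingroup all_algebra.
From mathcomp Require Import ring lra zify.
Set Implicit Arguments.
Unset Strict Implicit.
Unset Printing Implicit Defensive.
Import Order.TTheory GRing.Theory Num.Theory.
Local Open Scope ring_scope.

(** Up to the factor sigma2, the trace of the information matrix of a design is
    [b k] minus [sum_j loss (block j)] minus nonnegative multiples of [|r|^2] and
    [|M phi|^2], where the loss of an order is [sum_i (l0 n_i^2 + l1 h_i^2)].
    Uniform rows make [r] constant and [M phi = 0], which minimizes the last two
    terms; and since the loss depends only on which units share a treatment, all
    blocks of the design have the loss of [pi*].  It remains to see that [pi*]
    minimizes the loss.  In each case this follows from a bound on the
    contribution of a single treatment that is tight for [pi*].  For [k >= 2v]
    the bound is affine in [n_i]; for [k < 2v] it is a sum of prices of the units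
    occupied by the treatment, plus a constant. *)

(** * Symmetry and monotonicity of [phi] *)

Lemma phi_rev (R : rcfType) k (p : 'I_k) :
  phi R k (rev_ord p).+1 = - phi R k p.+1.
Proof.
rewrite /phi /= -mulrN; congr (_ * _).
have -> : ((k - p.+1).+1 = k - p)%N by have := ltn_ord p; lia.
by rewrite natrB ?(ltnW (ltn_ord p)) // -natr1; ring.
Qed.

Lemma sum_phi (R : rcfType) k : \sum_(p < k) phi R k p.+1 = 0.
Proof.
have: \sum_(p < k) phi R k p.+1 = - \sum_(p < k) phi R k p.+1.
  by rewrite {1}(reindex_inj rev_ord_inj) -sumrN; apply: eq_bigr => p _; exact: phi_rev.
lra.
Qed.

(** [phi] is affine in the unit and vanishes at the centre [(k + 1) / 2]; up to the centre its
    square can only decrease. *)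
Lemma phi_sqr_decr (R : rcfType) k p p' :
  (p <= p')%N -> (p'.*2 <= k.+1)%N -> phi R k p' ^+ 2 <= phi R k p ^+ 2.
Proof.
move=> le_pp' le_p'k; rewrite /phi !exprMn ler_wpM2l ?sqr_ge0 //.
have h1 : (p%:R : R) <= p'%:R by rewrite ler_nat.
have : ((p'.*2)%:R : R) <= k.+1%:R by rewrite ler_nat.
rewrite -muln2 natrM -[k.+1%:R]natr1 => h2.
by nra.
Qed.

Lemma natr_diff_sqr_ge1 (R : realDomainType) (m n : nat) :
  m != n -> 1 <= (m%:R - n%:R : R) ^+ 2.
Proof.
case: ltngtP => // lt_mn _; have := lt_mn; rewrite -(ler_nat R) -natr1 => H; nra.
Qed.

(** * The loss of an order and its lower bounds *)

Section Loss.
Variables (R : rcfType) (v k : nat) (l0 l1 : R).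
Implicit Types (f g : 'I_k -> 'I_v).

Definition freq f (i : 'I_v) : nat := #|[set p | f p == i]|.

Definition slope f (i : 'I_v) : R := \sum_(p < k | f p == i) phi R k p.+1.

Definition loss f : R :=
  \sum_i (l0 * (freq f i)%:R ^+ 2 + l1 * slope f i ^+ 2).

Lemma natr_freq f i : (freq f i)%:R = \sum_(p < k) (f p == i)%:R :> R.
Proof.
by rewrite /freq -sum1dep_card natr_sum big_mkcond; apply: eq_bigr => p _; case: (f p == i).
Qed.

Lemma sum_fiber_const f i (x : R) : \sum_(p < k | f p == i) x = (freq f i)%:R * x.
Proof.
rewrite natr_freq mulr_suml big_mkcond; apply: eq_bigr => p _.
by case: eqP; rewrite ?mul1r ?mul0r.
Qed.

Lemma slopeE f i : slope f i = \sum_(p < k) (f p == i)%:R * phi R k p.+1.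
Proof.
by rewrite /slope big_mkcond; apply: eq_bigr => p _; case: eqP; rewrite ?mul1r ?mul0r.
Qed.

Lemma sum_freq f : \sum_i (freq f i)%:R = k%:R :> R.
Proof.
rewrite -[k in RHS]card_ord -sum1_card natr_sum (partition_big f predT) //=.
by apply: eq_bigr => i _; rewrite sum_fiber_const mulr1.
Qed.

(** Expanding the squares gives a sum over pairs of units that share a treatment, so the loss sees
    only the partition of the units and not the labels. *)
Lemma lossE f : loss f =
  \sum_(p < k) \sum_(p' < k | f p' == f p) (l0 + l1 * (phi R k p.+1 * phi R k p'.+1)).
Proof.
rewrite [RHS](partition_big f predT) //=; apply: eq_bigr => i _.
rewrite (eq_bigr (fun p : 'I_k => l0 * (freq f i)%:R + l1 * (phi R k p.+1 * slope f i))); last first.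
  move=> p /eqP fp; rewrite big_split /= fp sum_fiber_const mulrC; congr (_ + _).
  by rewrite /slope !mulr_sumr.
rewrite big_split /= sum_fiber_const -mulr_sumr -mulr_suml -/(slope f i); ring.
Qed.

Lemma eq_loss f g :
  (forall p p', (f p == f p') = (g p == g p')) -> loss f = loss g.
Proof.
by move=> E; rewrite !lossE; apply: eq_bigr => p _; apply: eq_bigl => p'.
Qed.

Lemma freq_eq0 f i : freq f i = 0%N -> forall p, (f p == i) = false.
Proof.
by move/eqP; rewrite cards_eq0 => /eqP E p; have := in_set0 p; rewrite -E inE.
Qed.

Lemma slope_rev_closed f i :
  (forall p, f p = i -> f (rev_ord p) = i) -> slope f i = 0.
Proof.
move=> sym; suff: slope f i = - slope f i by lra.
rewrite {1}/slope (reindex_inj rev_ord_inj) -sumrN; apply: eq_big => [p|p _].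
  apply/eqP/eqP => [/sym|/sym //]; by rewrite rev_ordK.
exact: phi_rev.
Qed.

(** A parity argument: for even [k] each [2p - k - 1] is odd, so an odd number of them sums to an
    odd integer, whose square is at least 1, the value attained at [p = k / 2]. *)
Lemma slope_odd f i :
  ~~ odd k -> odd (freq f i) -> phi R k k./2 ^+ 2 <= slope f i ^+ 2.
Proof.
move=> evk odd_n.
pose N := (\sum_(p < k | f p == i) p.+1)%N.
have -> : slope f i = Num.sqrt (3 / (k%:R * (k%:R ^+ 2 - 1))) *
    ((N.*2)%:R - (freq f i * k.+1)%:R).
  rewrite /slope /phi -mulr_sumr; congr (_ * _).
  rewrite (eq_bigr (fun p : 'I_k => 2 * p.+1%:R - k.+1%:R)); last first.
    by move=> p _; rewrite -[k.+1%:R]natr1; ring.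
  rewrite sumrB sum_fiber_const -mulr_sumr -muln2 !natrM natr_sum; ring.
rewrite /phi !exprMn ler_wpM2l ?sqr_ge0 //.
have -> : 2 * (k./2)%:R - k%:R - 1 = -1 :> R.
  rewrite -{2}(even_halfK evk) -muln2 natrM; ring.
rewrite sqrrN expr1n natr_diff_sqr_ge1 //.
apply/eqP => /(congr1 odd); rewrite odd_double oddM odd_n /= evk //.
Qed.

(** Replications always sum to [k], so the affine bound has the same total [A k + B v] for every
    order. *)
Lemma loss_support (A B : R) f g :
  (forall i, l0 * (freq f i)%:R ^+ 2 + l1 * slope f i ^+ 2 = A * (freq f i)%:R + B) ->
  (forall i, A * (freq g i)%:R + B <= l0 * (freq g i)%:R ^+ 2 + l1 * slope g i ^+ 2) ->
  loss f <= loss g.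
Proof.
move=> Ef Lg; rewrite /loss (eq_bigr _ (fun i _ => Ef i)).
apply: le_trans (ler_sum _ (fun i _ => Lg i)).
by rewrite !big_split -!mulr_sumr !sum_freq.
Qed.

Hypotheses (l0_ge0 : 0 <= l0) (l1_ge0 : 0 <= l1).

(** The affine bound is the chord of [l0 * n^2] through [m] and [m + 1], which no integer point
    crosses because [(n - m)(n - m - 1) >= 0]. *)
Lemma loss_balanced m f g :
  (forall i, freq f i = m \/ freq f i = m.+1) -> (forall i, slope f i = 0) ->
  loss f <= loss g.
Proof.
move=> nf hf.
apply: (@loss_support (l0 * (2 * m%:R + 1)) (- (l0 * m%:R * (m%:R + 1)))) => i.
  by rewrite hf; case: (nf i) => ->; rewrite -?[m.+1%:R]natr1; ring.
have h2 : 0 <= l1 * slope g i ^+ 2 by rewrite mulr_ge0 ?sqr_ge0.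
suff /(mulr_ge0 l0_ge0) : 0 <= (((freq g i)%:R - m%:R) * ((freq g i)%:R - m%:R - 1) : R) by lra.
case: (leqP (freq g i) m) => H; have := H; rewrite -(ler_nat R) -?natr1; nra.
Qed.

(** The chord now passes through the even numbers [x] and [x + 2]. It exceeds [l0 * n^2] only at
    [n = x + 1], by [l0]; there [n] is odd and the slope term pays at least that much. *)
Lemma loss_parity_balanced x f g :
  ~~ odd k -> ~~ odd x -> l0 <= l1 * phi R k k./2 ^+ 2 ->
  (forall i, freq f i = x \/ freq f i = x.+2) -> (forall i, slope f i = 0) ->
  loss f <= loss g.
Proof.
move=> evk evx le_l0 nf hf.
apply: (@loss_support (l0 * (2 * x%:R + 2)) (- (l0 * x%:R * (x%:R + 2)))) => i.
  by rewrite hf; case: (nf i) => ->; rewrite -?[x.+2%:R]natr1 -?[x.+1%:R]natr1; ring.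
have h2 : 0 <= slope g i ^+ 2 by rewrite sqr_ge0.
have [odd_n|ev_n] := boolP (odd (freq g i)).
  have h3 := slope_odd evk odd_n.
  have h4 := ler_wpM2l l1_ge0 h3.
  suff : 0 <= l0 * (((freq g i)%:R - x%:R - 1) ^+ 2) by lra.
  by rewrite mulr_ge0 ?sqr_ge0.
have := mulr_ge0 l1_ge0 h2.
suff /(mulr_ge0 l0_ge0) : 0 <= (((freq g i)%:R - x%:R) * ((freq g i)%:R - x%:R - 2) : R) by lra.
case: (leqP (freq g i) x) => H.
  by have := H; rewrite -(ler_nat R); nra.
have : (x.+2 <= freq g i)%N by lia.
rewrite -(ler_nat R) -[x.+2%:R]natr1 -[x.+1%:R]natr1; nra.
Qed.

(* [n |-> l0 * n^2 + c * odd n] is convex on the integers as soon as [c <= l0]. *)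
Lemma quadratic_parity_support (c : R) (m n : nat) :
  0 <= c -> c <= l0 ->
  (l0 * (2 * m%:R + 1) + c * (1 - 2 * (odd m)%:R)) * n%:R
    + (c * (odd m)%:R * (2 * m%:R + 1) - c * m%:R - l0 * m%:R * (m%:R + 1))
  <= l0 * n%:R ^+ 2 + c * (odd n)%:R.
Proof.
move=> c0 cl.
have hints (s : nat) : (0 < s)%N -> [/\ 0 <= c * s%:R, 0 <= (l0 - c) * s%:R,
    0 <= l0 * (s%:R - 1) & 0 <= l0 * (s%:R * (s%:R - 1))].
  by rewrite -(ler1n R) => s_ge1; split; rewrite ?mulr_ge0 ?subr_ge0 // (le_trans ler01).
case: (leqP n m) => H.
  rewrite -(subnKC H) natrD oddD; set s := (m - n)%N.
  case: (posnP s) => [->|/hints[]]; first by case: (odd n) => /=; lra.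
  by case: (odd n); case: (odd s) => /=; lra.
rewrite -(subnKC H) natrD oddD /= -natr1; set s := (n - m.+1)%N.
case: (posnP s) => [->|/hints[]]; first by case: (odd m) => /=; lra.
by case: (odd m); case: (odd s) => /=; lra.
Qed.

(** By [slope_odd], an odd replication costs at least [c] in slope. When [c <= l0], the cost with
    this penalty still lies above its chord through [m] and [m + 1]. *)
Lemma loss_balanced_odd_slope m f g :
  ~~ odd k -> l1 * phi R k k./2 ^+ 2 <= l0 ->
  (forall i, freq f i = m \/ freq f i = m.+1) ->
  (forall i, slope f i ^+ 2 = phi R k k./2 ^+ 2 * (odd (freq f i))%:R) ->
  loss f <= loss g.
Proof.
move=> evk le_l0 nf hf; set c := l1 * _ in le_l0.
have c_ge0 : 0 <= c by rewrite mulr_ge0 ?sqr_ge0.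
apply: loss_support (fun i => le_trans (@quadratic_parity_support c m _ c_ge0 le_l0) _) => i.
  rewrite hf mulrA -/c; case: (nf i) => ->; rewrite -?[m.+1%:R]natr1 /=; case: (odd m) => /=; ring.
rewrite lerD2l; case: (boolP (odd _)) => [odd_n|_].
  by rewrite mulr1 ler_wpM2l // slope_odd.
by rewrite mulr0 mulr_ge0 ?sqr_ge0.
Qed.

(* Weak duality: each treatment pays at least the prices of its units minus
   [2 * (l0 - th)]; for the optimal [th] this is an equality at [pi_q]. *)
Lemma loss_dual (th : R) f : 0 <= th <= l0 ->
  \sum_(p < k) (l0 + Num.min (l1 * phi R k p.+1 ^+ 2) th + 2 * (l0 - th))
    - 2 * (l0 - th) * v%:R <= loss f.
Proof.
move=> /andP[th_ge0 le_th].
rewrite (partition_big f predT) //= -[in v%:R](card_ord v) -sum1_card natr_sum.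
rewrite mulr_sumr -sumrB; apply: ler_sum => i _; rewrite mulr1.
case E : (freq f i) => [|[|n]].
- have fF := freq_eq0 E.
  rewrite !big_pred0 // /slope big_pred0 //; lra.
- have /eqP/cards1P[p Ep] := E.
  have Ep' q : (f q == i) = (q == p) by have /setP/(_ q) := Ep; rewrite !inE.
  rewrite /slope !(big_pred1 p) //.
  have := ge_min (l1 * phi R k p.+1 ^+ 2) (l1 * phi R k p.+1 ^+ 2) th; rewrite lexx => h; lra.
(* With at least two units, every price is bounded through [min <= th]. The remaining gap for
   replication [n] is at least [l0 (n - 1)(n - 2) + th (n - 2)], zero at [n = 2]. *)
apply: (@le_trans _ _ (\sum_(p < k | f p == i) (3 * l0 - th) - 2 * (l0 - th))).
  rewrite lerD2r; apply: ler_sum => p _.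
  have := ge_min th (l1 * phi R k p.+1 ^+ 2) th; rewrite lexx orbT => h; lra.
rewrite sum_fiber_const E.
have : 0 <= l1 * slope f i ^+ 2 by rewrite mulr_ge0 ?sqr_ge0.
have : 0 <= n%:R :> R by [].
rewrite -[n.+2%:R]natr1 -[n.+1%:R]natr1; nra.
Qed.

End Loss.

(** * Which units share a treatment in [pi_q] *)

Lemma freq_tnth v k (pi : block_order v k) i : freq (tnth pi) i = rep pi i.
Proof. by []. Qed.

Lemma pi_q_kernel v k q (pi : block_order v k) (p p' : 'I_k) : is_pi_q q pi ->
  (tnth pi p' == tnth pi p) =
  (p' == p) || ((p < q)%N || (k - q <= p)%N) && (p' == rev_ord p).
Proof.
case=> _ le_q [s [uniq_s size_s pi_s]].
(* [fold] sends a unit to the index of its treatment in [s], reflecting the last [q] units onto the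
   first [q]; as [s] has no repetition, sharing a treatment means equal [fold]. *)
pose fold (r : 'I_k) := if (r < k - q)%N then nat_of_ord r else (k - r.+1)%N.
have fold_lt r : (fold r < size s)%N.
  rewrite /fold size_s; have := ltn_ord r; case: ifP; lia.
have foldE r : tnth pi r = nth (tnth pi p) s (fold r).
  rewrite (tnth_nth (tnth pi p)) pi_s nth_cat size_s /fold; case: ifP => // r_ge.
  have := ltn_ord r => r_lt.
  rewrite nth_rev size_takel ?size_s; try lia.
  by rewrite nth_take; [congr nth; lia | lia].
rewrite (foldE p) (foldE p') nth_uniq //.
have := ltn_ord p; have := ltn_ord p'; rewrite /fold -!val_eqE /=.
by case: ifP; case: ifP; lia.
Qed.

Lemma sum_zone (R : pzRingType) k q (x : R) : (q.*2 <= k)%N ->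
  \sum_(p < k) (if (p < q)%N || (k - q <= p)%N then x else 0) = x * (q.*2)%:R.
Proof.
move=> le_q; rewrite -(big_mkord predT (fun p => if (p < q)%N || (k - q <= p)%N then x else 0)).
rewrite (big_cat_nat (n := q)) /=; [|lia..]; rewrite (big_cat_nat (n := (k - q)%N) (m := q)) /=; [|lia..].
rewrite [X in _ + (X + _)]big_nat_cond [X in _ + (X + _)]big1 ?add0r; last first.
  move=> p /andP[/andP[p_ge p_lt] _]; rewrite ifF //; lia.
rewrite [X in X + _](eq_big_nat _ _ (F2 := fun=> x)); last by move=> p /andP[_ ->].
rewrite [X in _ + X](eq_big_nat _ _ (F2 := fun=> x)); last by move=> p /andP[-> _]; rewrite orbT.
rewrite !sumr_const_nat -mulrnDr mulr_natr; congr (_ *+ _); lia.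
Qed.

(** * Each optimal order minimizes the loss *)

Section Optimality.
Variables (R : rcfType) (v k : nat) (l0 l1 : R).
Hypotheses (l0_ge0 : 0 <= l0) (l1_ge0 : 0 <= l1).

(** In a mirrored pair the two values of [phi] are opposite, so the [l1] terms cancel and each of
    its units contributes [2 * l0]; inner units are alone. *)
Lemma loss_pi_q q (pi : block_order v k) : is_pi_q q pi ->
  loss l0 l1 (tnth pi) =
  \sum_(p < k) (if (p < q)%N || (k - q <= p)%N then 2 * l0 else l0 + l1 * phi R k p.+1 ^+ 2).
Proof.
move=> piq; rewrite lossE; apply: eq_bigr => p _.
rewrite (eq_bigl _ _ (fun p' => pi_q_kernel p p' piq)).
case: piq => _ le_q _; case: ifP => out_p /=.
  have ne_rev : rev_ord p != p by rewrite -val_eqE /=; have := ltn_ord p; lia.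
  rewrite (bigD1 p) ?eqxx //= (big_pred1 (rev_ord p)).
    rewrite phi_rev; ring.
  by move=> p' /=; case: (eqVneq p' p) => [->|_] /=; rewrite ?andbT // eq_sym (negbTE ne_rev).
rewrite (big_pred1 p) //; first by move=> p'; rewrite /= orbF.
Qed.

Lemma phi_sqr_fold (p : 'I_k) (P : R -> Prop) :
  (forall r, (r.+1.*2 <= k.+1)%N -> (r = p \/ r = rev_ord p) -> P (phi R k r.+1 ^+ 2)) ->
  P (phi R k p.+1 ^+ 2).
Proof.
move=> HP; case: (leqP p.+1.*2 k.+1) => H; first by apply: HP => //; left.
have -> : phi R k p.+1 ^+ 2 = phi R k (rev_ord p).+1 ^+ 2 by rewrite phi_rev sqrrN.
by apply: HP; [have := ltn_ord p; rewrite /=; lia | right].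
Qed.

(** Complementary slackness: [th] separates the outer values of [l1 * phi^2] from the inner ones,
    which evaluates each minimum in [loss_dual]. The bound then differs from the loss of [pi_q] by
    [2 (l0 - th)(q + v - k)], zero by the last hypothesis. *)
Lemma loss_pi_q_min (th : R) q (pi : block_order v k) (f : 'I_k -> 'I_v) :
  is_pi_q q pi -> 0 <= th <= l0 ->
  (forall p, (p < q)%N -> th <= l1 * phi R k p.+1 ^+ 2) ->
  (forall p, (q <= p)%N -> (p.+1.*2 <= k.+1)%N -> l1 * phi R k p.+1 ^+ 2 <= th) ->
  (l0 - th) * (q%:R + v%:R - k%:R) = 0 ->
  loss l0 l1 (tnth pi) <= loss l0 l1 f.
Proof.
move=> piq th_int Hout Hin tight; apply: le_trans (loss_dual l1_ge0 f th_int).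
rewrite (loss_pi_q piq); case: piq => _ le_q _.
have -> : \sum_(p < k) (l0 + Num.min (l1 * phi R k p.+1 ^+ 2) th + 2 * (l0 - th)) =
    \sum_(p < k) (if (p < q)%N || (k - q <= p)%N then 2 * l0 else l0 + l1 * phi R k p.+1 ^+ 2)
    - \sum_(p < k) (if (p < q)%N || (k - q <= p)%N then l0 - th else 0)
    + 2 * (l0 - th) * k%:R.
  have -> : 2 * (l0 - th) * k%:R = \sum_(p < k) (2 * (l0 - th)).
    by rewrite sumr_const card_ord mulr_natr.
  rewrite -sumrB -big_split /=.
  apply: eq_bigr => p _; case: ifP => out_p.
    suff : th <= l1 * phi R k p.+1 ^+ 2 by move/min_idPr => ->; ring.
    have := ltn_ord p; apply: (@phi_sqr_fold p (fun x => _ -> th <= l1 * x)) => r r_le rp p_lt.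
    by apply: Hout; case: rp r_le => -> /=; lia.
  suff : l1 * phi R k p.+1 ^+ 2 <= th by move/min_idPl => ->; ring.
  have := ltn_ord p; apply: (@phi_sqr_fold p (fun x => _ -> l1 * x <= th)) => r r_le rp p_lt.
  by apply: Hin => //; case: rp r_le => -> /=; lia.
rewrite sum_zone // -muln2 natrM; lra.
Qed.

Lemma s_star_outer p : (p < s_star k l0 l1)%N -> l0 <= l1 * phi R k p.+1 ^+ 2.
Proof.
rewrite /s_star; case: ifP => // _; set s := (\max_(_ <= _ < _ | _) _)%N => lt_ps.
(* The big maximum is either its default value 0 or satisfies the filter itself. *)
have [s0|/andP[s_le s_gt]] : s = 0%N \/ (s.*2 < k.+1)%N && (l0 < l1 * phi R k s ^+ 2).
  rewrite /s; elim/big_ind: _ => [|x y Hx Hy|x ->]; [by left| |by right].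
  by rewrite /maxn; case: ifP.
- by rewrite s0 in lt_ps.
apply/ltW/(lt_le_trans s_gt); rewrite ler_wpM2l //; apply: phi_sqr_decr => //; lia.
Qed.

Lemma s_star_inner p : (s_star k l0 l1 <= p)%N -> (p.+1.*2 < k.+1)%N ->
  l1 * phi R k p.+1 ^+ 2 <= l0.
Proof.
rewrite /s_star; case: ifP => [_|/negbT H] le_sp p_lt; rewrite leNgt.
  apply/negP => lt_l0; suff : (p.+1 <= p)%N by rewrite ltnn.
  apply: leq_trans le_sp.
  apply: (@leq_bigmax_seq _ _ _ (fun p => p) p.+1); last by rewrite p_lt.
  by rewrite mem_index_iota; lia.
apply: contra H => /lt_le_trans; apply; rewrite ler_wpM2l //; apply: phi_sqr_decr => //; lia.
Qed.

Lemma phi_middle : odd k -> phi R k (k.+1)./2 = 0.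
Proof.
move=> odd_k; rewrite /phi; have -> : k.+1./2 = k./2.+1 by lia.
have -> : 2 * (k./2.+1)%:R - k%:R - 1 = 0 :> R; last by rewrite mulr0.
have -> : k%:R = 1 + 2 * (k./2)%:R :> R; last by rewrite -natr1; ring.
by rewrite -{1}(odd_double_half k) odd_k -mul2n natrD natrM.
Qed.

(** The range defining [s_star] omits the middle unit of an odd [k]; there [phi] vanishes, so the
    bound extends to it. *)
Lemma phi_sqr_inner_le (th : R) q : 0 <= th ->
  (forall p, (q <= p)%N -> (p.+1.*2 < k.+1)%N -> l1 * phi R k p.+1 ^+ 2 <= th) ->
  (forall p, (q <= p)%N -> (p.+1.*2 <= k.+1)%N -> l1 * phi R k p.+1 ^+ 2 <= th).
Proof.
move=> th_ge0 H p le_qp; rewrite leq_eqVlt => /orP[/eqP pk|]; last exact: H.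
have -> : p.+1 = (k.+1)./2 by lia.
by rewrite phi_middle ?expr0n ?mulr0 //; lia.
Qed.

Lemma structure_S_slope (pi : block_order v k) i :
  structure_S pi -> ~~ odd (rep pi i) -> slope R (tnth pi) i = 0.
Proof.
case=> _ out mir ev_i; apply: slope_rev_closed => p pi_p.
by rewrite -mir // -out pi_p.
Qed.

Lemma structure_S_rep (pi : block_order v k) i :
  structure_S pi -> freq (tnth pi) i = (k %/ v)%N \/ freq (tnth pi) i = (k %/ v).+1.
Proof. by case=> repE _ _; rewrite freq_tnth repE; case: ifP; [right|left]. Qed.

Lemma mirrored_slope (pi : block_order v k) i :
  mirrored pi -> slope R (tnth pi) i = 0.
Proof. by move=> mir; apply: slope_rev_closed => p <-; rewrite -mir. Qed.

Lemma phi_sqr_half_succ : ~~ odd k -> phi R k (k.+2)./2 ^+ 2 = phi R k k./2 ^+ 2.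
Proof.
move=> ev_k; rewrite /phi !exprMn; congr (_ * _).
rewrite /= -natr1; have -> : k%:R = 2 * (k./2)%:R :> R; last by ring.
by rewrite -{1}(even_halfK ev_k) -muln2 natrM mulrC.
Qed.

Lemma optimal_order_loss_min (pi : block_order v k) (f : 'I_k -> 'I_v) :
  optimal_order l0 l1 pi -> loss l0 l1 (tnth pi) <= loss l0 l1 f.
Proof.
rewrite /optimal_order; case: ifP => _.
  case: ifP => [_ piq|/negbT]; last rewrite -ltnNge => lt_k piq.
    (* [s_star] is where [l1 * phi^2] crosses [l0], so the threshold is [l0] and the slackness
       product vanishes by its first factor. *)
    apply: (loss_pi_q_min (th := l0)) piq _ _ _ _; rewrite ?lexx ?l0_ge0 ?subrr ?mul0r //.
      exact: s_star_outer.
    by apply: phi_sqr_inner_le => //; exact: s_star_inner.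
  have le_q : ((k - v).*2 <= k)%N by case: piq.
  (* Here [q = k - v] kills the second slackness factor, leaving [th] free: it is taken as
     [l1 * phi^2] at the last unit of the first outer zone, of ordinal [a]. Since [a] is at least
     [s_star], this is at most [l0]. *)
  pose a := (k - v).-1.
  have aE : a.+1 = (k - v)%N by rewrite /a prednK //; lia.
  have th_ge0 : 0 <= l1 * phi R k a.+1 ^+ 2 by rewrite mulr_ge0 ?sqr_ge0.
  apply: (loss_pi_q_min (th := l1 * phi R k a.+1 ^+ 2)) piq _ _ _ _.
  - by rewrite th_ge0 s_star_inner //; lia.
  - by move=> p p_lt; rewrite ler_wpM2l // phi_sqr_decr //; lia.
  - by move=> p p_lt p_k; rewrite ler_wpM2l // phi_sqr_decr //; lia.
  by rewrite -natrD subnK ?subrr ?mulr0 //; lia.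
case: ifP => [odd_k [piS odd0]|/negbT ev_k].
  apply: (loss_balanced l0_ge0 l1_ge0 (m := (k %/ v)%N)) => i; first exact: structure_S_rep.
  by have [/odd0//|] := boolP (odd (rep pi i)); apply: structure_S_slope.
case: ifP => [_ [repE mir]|_].
  apply: (loss_balanced l0_ge0 l1_ge0 (m := (k %/ v)%N)) => i; last exact: mirrored_slope.
  by left; apply: repE.
case: ifP => [lt_l0 [repE mir]|/negbT].
  apply: (loss_parity_balanced l0_ge0 l1_ge0 (x := even_floor (k %/ v))) (ltW lt_l0) repE _ => //.
    by rewrite /even_floor; case: ifP; lia.
  by move=> i; exact: mirrored_slope.
rewrite -leNgt => le_l0 [piS oddE].
apply: (loss_balanced_odd_slope l0_ge0 l1_ge0 (m := (k %/ v)%N)) => // i; first exact: structure_S_rep.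
rewrite freq_tnth; have [odd_i|ev_i] := boolP (odd (rep pi i)).
  by rewrite mulr1 -phi_sqr_half_succ // -(oddE i odd_i) real_normK ?num_real.
by rewrite structure_S_slope // expr0n mulr0.
Qed.

End Optimality.

(** * Trace and complete symmetry of the information matrix *)

Section Information.
Variables (R : rcfType) (v k b : nat) (l0 l1 : R).
Implicit Types (d : design v k b).

Definition pair_count d p p' i i' : nat := #|[set j | (d p j == i) && (d p' j == i')]|.

Lemma natr_pair_count d p p' i i' :
  (pair_count d p p' i i')%:R = \sum_j (d p j == i)%:R * (d p' j == i')%:R :> R.
Proof.
rewrite /pair_count -sum1dep_card natr_sum big_mkcond; apply: eq_bigr => j _.
by case: (d p j == i); case: (d p' j == i'); rewrite /= ?mulr1 ?mulr0.
Qed.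

Lemma within_blockE d i i' :
  (\sum_(j < b) (incidence R d j)^T *m weight k l0 l1 *m incidence R d j) i i' =
  \sum_p \sum_p' weight k l0 l1 p p' * (pair_count d p p' i i')%:R.
Proof.
rewrite summxE.
have quad j : ((incidence R d j)^T *m weight k l0 l1 *m incidence R d j) i i' =
    \sum_p \sum_p' weight k l0 l1 p p' * ((d p j == i)%:R * (d p' j == i')%:R).
  rewrite -mulmxA mxE; apply: eq_bigr => p _.
  rewrite mxE [X in _ * X]mxE mulr_sumr; apply: eq_bigr => p' _.
  by rewrite mulrCA; congr (_ * _); rewrite !mxE.
rewrite (eq_bigr _ (fun j _ => quad j)) exchange_big; apply: eq_bigr => p _.
rewrite exchange_big; apply: eq_bigr => p' _.
by rewrite natr_pair_count mulr_sumr.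
Qed.

Lemma weight_sym p p' : weight k l0 l1 p p' = weight k l0 l1 p' p.
Proof. by rewrite !mxE !big_ord1 !mxE eq_sym [phi R k p.+1 * _]mulrC. Qed.

Lemma mxtrace_mul_tr n (u : 'cV[R]_n) : \tr (u *m u^T) = \sum_i u i 0 ^+ 2.
Proof. by apply: eq_bigr => i _; rewrite mxE big_ord1 mxE -expr2. Qed.

(** For the incidence matrix [X] of the block, [X' X] has trace [k], while [X' 1] and [X' phi] are
    the vectors of replications and slopes, whose squared norms make up the loss. *)
Lemma trace_within_block d j :
  \tr ((incidence R d j)^T *m weight k l0 l1 *m incidence R d j)
    = k%:R - loss l0 l1 (d^~ j).
Proof.
set X := incidence R d j.
have gram (u : 'cV[R]_k) : X^T *m (u *m u^T) *m X = (X^T *m u) *m (X^T *m u)^T.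
  by rewrite trmx_mul trmxK !mulmxA.
have entry (u : 'cV[R]_k) i : (X^T *m u) i 0 = \sum_p (d p j == i)%:R * u p 0.
  by rewrite mxE; apply: eq_bigr => p _; rewrite !mxE.
rewrite /weight !mulmxBr !mulmxBl -!scalemxAr -!scalemxAl !gram mulmx1.
rewrite !raddfB /= !mxtraceZ !mxtrace_mul_tr -addrA -opprD; congr (_ - _).
  rewrite mxtrace_mulC /mxtrace.
  rewrite (eq_bigr (fun=> 1)) ?sumr_const ?card_ord // => p _.
  rewrite !mxE (bigD1 (d p j)) //= !mxE eqxx mulr1 big1 ?addr0 // => i ne_i.
  by rewrite !mxE eq_sym (negbTE ne_i) mulr0.
rewrite /loss big_split /= !mulr_sumr; congr (_ + _); apply: eq_bigr => i _.
  rewrite entry natr_freq; do 2 congr (_ * _); apply: eq_bigr => p _; by rewrite mxE mulr1.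
by rewrite entry slopeE; do 2 congr (_ * _); apply: eq_bigr => p _; rewrite mxE.
Qed.

Lemma trace_min_info sigma2 d :
  \tr (min_info sigma2 l0 l1 d) = sigma2^-1 *
    (b%:R * k%:R - \sum_j loss l0 l1 (d^~ j)
     - (1 - k%:R * l0) / (b%:R * k%:R) * \sum_i replication R d i 0 ^+ 2
     - (1 - l1) / b%:R * \sum_i (unit_incidence R d *m phi_col R k) i 0 ^+ 2).
Proof.
rewrite /min_info mxtraceZ !raddfB /= !mxtraceZ mxtrace_mul_tr.
rewrite -[_ *m (unit_incidence R d)^T]mulmxA -trmx_mul mxtrace_mul_tr.
rewrite raddf_sum /= (eq_bigr _ (fun j _ => trace_within_block d j)).
by rewrite sumrB sumr_const card_ord [b%:R * _]mulr_natl.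
Qed.

Lemma sum_replication d : \sum_i replication R d i 0 = b%:R * k%:R.
Proof.
rewrite -natrM -[in RHS](card_ord b) -[in RHS](card_ord k) mulnC -card_prod -sum1_card natr_sum.
rewrite (partition_big (fun c : 'I_k * 'I_b => d c.1 c.2) predT) //=.
by apply: eq_bigr => i _; rewrite mxE -sum1dep_card natr_sum.
Qed.

Lemma replicationE d i : replication R d i 0 = \sum_p unit_incidence R d i p.
Proof.
rewrite mxE -sum1dep_card natr_sum -(pair_big_dep predT (fun p j => d p j == i) (fun _ _ => 1)) /=.
by apply: eq_bigr => p _; rewrite mxE -sum1dep_card natr_sum.
Qed.

Lemma sum_sqr_const_min n (x y : 'I_n -> R) a : (forall i, x i = a) ->
  \sum_i x i = \sum_i y i -> \sum_i x i ^+ 2 <= \sum_i y i ^+ 2.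
Proof.
move=> xa sum_xy.
(* Decomposition of the sum of squares around the common value [a]. *)
have -> : \sum_i y i ^+ 2 = \sum_i (y i - a) ^+ 2 + \sum_i x i ^+ 2.
  have -> : \sum_i x i ^+ 2 = 2 * a * \sum_i x i - \sum_(i < n) a ^+ 2.
    by rewrite mulr_sumr -sumrB; apply: eq_bigr => i _; rewrite xa; ring.
  rewrite sum_xy mulr_sumr -sumrB -big_split; apply: eq_bigr => i _ /=; ring.
by rewrite lerDr sumr_ge0 // => i _; exact: sqr_ge0.
Qed.

Lemma trace_min_info_max sigma2 a d d' :
  0 < sigma2 -> k%:R * l0 <= 1 -> l1 <= 1 ->
  (forall p i, unit_incidence R d i p = a) ->
  (forall j, loss l0 l1 (d^~ j) <= loss l0 l1 (d'^~ j)) ->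
  \tr (min_info sigma2 l0 l1 d') <= \tr (min_info sigma2 l0 l1 d).
Proof.
move=> s2 kl0 l1_le unif Lmin; rewrite !trace_min_info ler_wpM2l ?invr_ge0 1?(ltW s2) //.
apply: lerB; first (apply: lerB; first by rewrite lerD2l lerN2 ler_sum).
  rewrite ler_wpM2l ?divr_ge0 ?subr_ge0 ?mulr_ge0 //.
  apply: (@sum_sqr_const_min _ _ _ (k%:R * a)); last by rewrite !sum_replication.
  move=> i; rewrite replicationE (eq_bigr _ (fun p _ => unif p i)) sumr_const card_ord.
  by rewrite mulr_natl.
rewrite ler_wpM2l ?divr_ge0 ?subr_ge0 // big1 => [|i _].
  by rewrite sumr_ge0 // => i _; exact: sqr_ge0.
rewrite mxE (eq_bigr (fun p : 'I_k => a * phi R k p.+1)) => [|p _]; last by rewrite unif mxE.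
by rewrite -mulr_sumr sum_phi mulr0 expr0n.
Qed.

(** With uniform rows the replication product is a constant matrix and [M phi = 0], so only the
    within-block sum can break symmetry. *)
Lemma min_info_completely_symmetric sigma2 a d :
  (forall p i, unit_incidence R d i p = a) ->
  completely_symmetric
    (\sum_(j < b) (incidence R d j)^T *m weight k l0 l1 *m incidence R d j) ->
  completely_symmetric (min_info sigma2 l0 l1 d).
Proof.
move=> unif; set S := \sum_(j < b) _ => -[Sdiag Soff].
have rE i : replication R d i 0 = k%:R * a.
  rewrite replicationE (eq_bigr _ (fun p _ => unif p i)) sumr_const card_ord.
  by rewrite mulr_natl.
have mE i : (unit_incidence R d *m phi_col R k) i 0 = 0.
  rewrite mxE (eq_bigr (fun p : 'I_k => a * phi R k p.+1)) => [|p _]; last by rewrite unif mxE.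
  by rewrite -mulr_sumr sum_phi mulr0.
have entry i i' : min_info sigma2 l0 l1 d i i' =
    sigma2^-1 * (S i i' - (1 - k%:R * l0) / (b%:R * k%:R) * (k%:R * a) ^+ 2).
  rewrite /min_info -/S -[_ *m (unit_incidence R d)^T]mulmxA -trmx_mul.
  rewrite !mxE !big_ord1 [(replication R d)^T _ _]mxE !rE.
  by rewrite [(unit_incidence R d *m phi_col R k)^T _ _]mxE !mE mulr0 mulr0 subr0 expr2.
split=> [i i'|i1 i2 i3 i4 ne12 ne34]; rewrite !entry; first by rewrite (Sdiag i i').
by rewrite (Soff i1 i2 i3 i4).
Qed.

Lemma uniform_rows_incidence n (e : 'M['I_v]_(n, b)) p i :
  uniform_rows e -> #|[set j | e p j == i]|%:R = b%:R / v%:R :> R.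
Proof.
move=> unif; have v_neq0 : v%:R != 0 :> R by rewrite pnatr_eq0 -lt0n; case: i => i /=; lia.
apply: (mulIf v_neq0); rewrite divfK // -natrM; congr (_%:R).
rewrite -[in RHS](card_ord b) -[in RHS]sum1_card (partition_big (e p) predT) //=.
rewrite (eq_bigr (fun=> #|[set j | e p j == i]|)) => [|i' _]; last first.
  by rewrite (unif p i i') -sum1dep_card.
by rewrite sum_nat_const card_ord mulnC.
Qed.

Lemma eq_set2 (T : finType) (x y z t : T) : z != t ->
  ([set x; y] == [set z; t]) = (x == z) && (y == t) || (x == t) && (y == z).
Proof.
move=> ne_zt; rewrite eqEsubset !subUset !sub1set !inE ![z == _]eq_sym ![t == _]eq_sym.
have [->|_] := eqVneq x z; have [->|_] := eqVneq y z; rewrite ?(negbTE ne_zt) ?andbF //=.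
  by rewrite orbF andbb; case: (y == t).
by rewrite orbF andbT; case: (x == t).
Qed.

Lemma semibalanced_within_block n (e : 'M['I_v]_(n, b)) (rho : 'I_k -> 'I_n) d :
  semibalanced e -> uniform_rows e -> (forall p j, d p j = e (rho p) j) ->
  completely_symmetric
    (\sum_(j < b) (incidence R d j)^T *m weight k l0 l1 *m incidence R d j).
Proof.
move=> [inj_e bal] unif dE; split=> [i i'|i1 i2 i3 i4 ne12 ne34].
  rewrite !within_blockE; apply: eq_bigr => p _; apply: eq_bigr => p' _; congr (_ * _%:R).
  rewrite /pair_count; have [E|ne] := eqVneq (rho p) (rho p').
    transitivity #|[set j | e (rho p) j == i]|; last rewrite (unif (rho p) i i').
      by apply: eq_card => j; rewrite !inE !dE -E andbb.
    by apply: eq_card => j; rewrite !inE !dE -E andbb.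
  have none x : [set j | (d p j == x) && (d p' j == x)] = set0.
    apply/setP => j; rewrite !inE !dE; apply/negP => /andP[/eqP <- /eqP /inj_e E].
    by rewrite E eqxx in ne.
  by rewrite !none.
(* Semibalance controls only unordered pairs. Since [weight] is symmetric, twice an off-diagonal
   entry involves only the counts [N] over both orderings. *)
pose N p p' x y := (pair_count d p p' x y + pair_count d p p' y x)%N.
have twice x y : (\sum_(j < b) (incidence R d j)^T *m weight k l0 l1 *m incidence R d j) x y *+ 2
    = \sum_p \sum_p' weight k l0 l1 p p' * (N p p' x y)%:R.
  rewrite mulr2n {2}within_blockE exchange_big within_blockE -big_split; apply: eq_bigr => p _.
  rewrite -big_split; apply: eq_bigr => p' _ /=.
  rewrite [weight _ _ _ p' p]weight_sym -mulrDr -natrD; congr (_ * (_ + _)%:R).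
  by apply: eq_card => j; rewrite !inE andbC.
have NE p p' x y : x != y -> N p p' x y =
    if rho p == rho p' then 0%N else #|[set j | [set e (rho p) j; e (rho p') j] == [set x; y]]|.
  move=> ne_xy; rewrite /N /pair_count -cardsUI.
  rewrite [_ :&: _](_ : _ = set0); last first.
    by apply/setP => j; rewrite !inE; case: (eqVneq (d p j) x) => // ->; rewrite (negbTE ne_xy) andbF.
  rewrite cards0 addn0; case: eqP => [E|_].
    apply/eqP; rewrite cards_eq0; apply/eqP/setP => j; rewrite !inE !dE -E.
    by case: (eqVneq _ x) => [->|_]; rewrite ?(negbTE ne_xy) ?andbF.
  by apply: eq_card => j; rewrite !inE eq_set2 // !dE.
have E (x y : R) : x *+ 2 = y *+ 2 -> x = y by lra.
apply: E; rewrite !twice; apply: eq_bigr => p _; apply: eq_bigr => p' _; congr (_ * _%:R).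
by rewrite !NE //; case: (eqVneq (rho p) (rho p')) => // ne; apply: bal.
Qed.

End Information.

(** * Designs whose rows repeat those of a semibalanced array *)

Lemma semibalanced_extension_rows (T : Type) (n l b k : nat) (k_eq : (n + l = k)%N)
  (d1 : 'M[T]_(n, b)) (d2 : 'M[T]_(l, b)) (Pi : 'S_k) :
  (forall q : 'I_l, exists p : 'I_n, row q d2 = row p d1) ->
  exists rho : 'I_k -> 'I_n, forall p j,
    row_perm Pi (castmx (k_eq, erefl b) (col_mx d1 d2)) p j = d1 (rho p) j.
Proof.
move=> /fin_all_exists[f fE]; case: k / k_eq Pi => Pi.
exists (fun p => match split (Pi p) with inl q => q | inr q => f q end) => p j.
rewrite castmx_id !mxE; case: split => // q.
by have /rowP/(_ j) := fE q; rewrite !mxE.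
Qed.

Theorem theorem3p6 (R : rcfType) (v k b : nat) (sigma2 lambda0 lambda1 : R)
  (v_ge1 : (1 <= v)%N) (k_ge2 : (2 <= k)%N) (b_ge1 : (1 <= b)%N)
  (sigma2_gt0 : 0 < sigma2)
  (lambda0_ge0 : 0 <= lambda0) (lambda0_le : lambda0 <= 1 / k%:R)
  (lambda1_ge0 : 0 <= lambda1) (lambda1_le : lambda1 <= 1)
  (pi : block_order v k) (pi_opt : optimal_order lambda0 lambda1 pi)
  (d1 : 'M['I_v]_(n_distinct pi, b))
  (d1_semibalanced : semibalanced d1) (d1_uniform : uniform_rows d1)
  (l : nat) (d2 : 'M['I_v]_(l, b))
  (d2_rows : forall q : 'I_l, exists p : 'I_(n_distinct pi), row q d2 = row p d1)
  (k_eq : (n_distinct pi + l = k)%N)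
  (Pi : 'S_k) (d : design v k b)
  (d_eq : d = row_perm Pi (castmx (k_eq, erefl b) (col_mx d1 d2)))
  (relabel : {perm 'I_v})
  (d_block1 : forall p : 'I_k, relabel (d p (Ordinal b_ge1)) = tnth pi p) :
  maximin_universally_optimal sigma2 lambda0 lambda1 d.
Proof.
have [rho dE] := semibalanced_extension_rows k_eq Pi d2_rows; rewrite -d_eq in dE.
have unif p i : unit_incidence R d i p = b%:R / v%:R.
  rewrite mxE -(uniform_rows_incidence R (rho p) i d1_uniform); congr (_%:R).
  by apply: eq_card => j; rewrite !inE dE.
split.
  apply: min_info_completely_symmetric unif _.
  exact: semibalanced_within_block d1_semibalanced d1_uniform dE.
have kl0 : k%:R * lambda0 <= 1.
  have k_gt0 : 0 < k%:R :> R by rewrite ltr0n; lia.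
  by rewrite mulrC -ler_pdivlMr.
move=> d'; apply: trace_min_info_max unif _ => // j.
suff <- : loss lambda0 lambda1 (tnth pi) = loss lambda0 lambda1 (d^~ j).
  exact: optimal_order_loss_min.
(* Columns of [d1] have distinct symbols, so in any block two units share a treatment exactly when
   [rho] sends them to the same row. This partition is the same in all blocks, and block 1
   identifies it with that of [pi] up to relabeling. *)
apply: eq_loss => p p'.
by rewrite -!d_block1 (inj_eq perm_inj) !dE !(inj_eq (d1_semibalanced.1 _)).
Qed.
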